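(* Let $m_3(s) = f_0 + g^T s + \frac12 H[s]^2 + \frac16 T[s]^3 + \frac{\sigma}{4}\|s\|_W^4$ for $s\in\mathbb{R}^n$. Assume $s_*\in\mathbb{R}^n$ satisfies $$\Big(H + \tfrac12 T[s_*] + \sigma\|s_*\|_W^2 W\Big)s_* = -g$$ and $$H + \frac23 T[s_*] + \sigma\|s_*\|_W^2 W - \frac{\Lambda_W}{3}\|s_*\|_W W - \frac{\Lambda_W^2}{18\sigma}W \succeq 0 .$$ Then $s_*$ is a global minimum of $m_3$ over $\mathbb{R}^n$.
   Context: Here $f_0\in\mathbb{R}$, $g\in\mathbb{R}^n$, $H\in\mathbb{R}^{n\times n}$ is a symmetric matrix, $T\in\mathbb{R}^{n\times n\times n}$ is a symmetric third-order tensor (entries invariant under permutation of indices), $\sigma>0$, and $W\in\mathbb{R}^{n\times n}$ is symmetric positive definite, with $\|v\|_W=\sqrt{v^TWv}$. Notation: $H[s]^2=s^THs$; $T[s]^3=\sum_{i,j,k}T_{ijk}s_is_js_k$; $T[s]$ is the symmetric matrix with entries $\sum_k T_{ijk}s_k$; $T[u][v]^2=\sum_{i,j,k}T_{ijk}u_iv_jv_k$. The weighted tensor norm is $$\Lambda_W=\max_{u,v\in\mathbb{R}^n\setminus\{0\}}\frac{|T[u][v]^2|}{\|u\|_W\|v\|_W^2}.$$ $A\succeq 0$ means that the symmetric matrix $A$ is positive semidefinite. *)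

(* Defs.v *)
From mathcomp Require Import all_boot all_order all_algebra.
From mathcomp Require Import all_classical all_reals.

Set Implicit Arguments.
Unset Strict Implicit.
Unset Printing Implicit Defensive.

Import Order.TTheory GRing.Theory Num.Theory.
Local Open Scope ring_scope.
Local Open Scope classical_set_scope.

Definition tensor3 (R : Type) (n : nat) := 'I_n -> 'I_n -> 'I_n -> R.

(* Invariance under the five non-identity permutations of the indices. *)
Definition symmetric_tensor (R : Type) (n : nat) (T : tensor3 R n) : Prop :=
  forall i j k : 'I_n,
    [/\ T i k j = T i j k,
        T j i k = T i j k,
        T j k i = T i j k,
        T k i j = T i j k
      & T k j i = T i j k].

Definition symmetric_mx (R : realType) (n : nat) (A : 'M[R]_n) : Prop :=
  A^T = A.

(* A[s]^2; the product is a 1 x 1 matrix, hence the projection. *)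
Definition quad (R : realType) (n : nat) (A : 'M[R]_n) (s : 'cV[R]_n) : R :=
  (s^T *m A *m s) 0 0.

Definition psd (R : realType) (n : nat) (A : 'M[R]_n) : Prop :=
  symmetric_mx A /\ forall v : 'cV[R]_n, 0 <= quad A v.

Definition posdef (R : realType) (n : nat) (A : 'M[R]_n) : Prop :=
  symmetric_mx A /\ forall v : 'cV[R]_n, v != 0 -> 0 < quad A v.

Definition wnorm (R : realType) (n : nat) (W : 'M[R]_n) (v : 'cV[R]_n) : R :=
  Num.sqrt (quad W v).

(* T[s] *)
Definition tensor_mx (R : realType) (n : nat) (T : tensor3 R n)
    (s : 'cV[R]_n) : 'M[R]_n :=
  \matrix_(i, j) \sum_k T i j k * s k 0.

(* T[s]^3 *)
Definition cubic (R : realType) (n : nat) (T : tensor3 R n)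
    (s : 'cV[R]_n) : R :=
  \sum_i \sum_j \sum_k T i j k * s i 0 * s j 0 * s k 0.

(* T[u][v]^2 *)
Definition tensor_uvv (R : realType) (n : nat) (T : tensor3 R n)
    (u v : 'cV[R]_n) : R :=
  \sum_i \sum_j \sum_k T i j k * u i 0 * v j 0 * v k 0.

(* The greatest element of A; 0 if A has none. *)
Definition set_max (R : realType) (A : set R) : R := xget 0 (A `&` ubound A).

(* For n > 0 and W positive definite this maximum is attained, so the default
   of set_max plays no role; for n = 0 there are no nonzero vectors and
   Lambda W T = 0. *)
Definition Lambda (R : realType) (n : nat) (W : 'M[R]_n) (T : tensor3 R n)
    : R :=
  set_max [set r | exists u v : 'cV[R]_n,
    [/\ u != 0, v != 0
      & r = `|tensor_uvv T u v| / (wnorm W u * wnorm W v ^+ 2)]].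

Definition m3 (R : realType) (n : nat) (f0 : R) (g : 'cV[R]_n) (H : 'M[R]_n)
    (T : tensor3 R n) (sigma : R) (W : 'M[R]_n) (s : 'cV[R]_n) : R :=
  f0 + (g^T *m s) 0 0 + 1 / 2 * quad H s + 1 / 6 * cubic T s
  + sigma / 4 * wnorm W s ^+ 4.

Definition global_minimum (R : realType) (n : nat) (f : 'cV[R]_n -> R)
    (x : 'cV[R]_n) : Prop :=
  forall y : 'cV[R]_n, f x <= f y.

(* Main.v *)
(** Write [p = |y|_W], [q = |s|_W] for the critical point [s], and [v = y - s].
    Eliminating [g] with the first-order condition gives
      [m3 y - m3 s = 1/2 (H[v]^2 + T[s][v]^2 + sigma q^2 |v|^2) + 1/6 T[v]^3
                     + sigma/4 (p^2 - q^2)^2].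
    The second-order condition absorbs [H[v]^2] and two thirds of [T[s][v]^2]; the
    remaining third combines with [T[v]^3] into [1/6 T[y][v]^2], which is at least
    [- Lambda/6 p |v|^2].  As [|v| <= p + q], the last term is at least
    [sigma/4 (p - q)^2 |v|^2], so the difference is bounded below by [|v|^2] times
      [sigma/4 (p - q)^2 - Lambda/6 (p - q) + Lambda^2 / (36 sigma)],
    a perfect square. *)
Require Import Defs.
From mathcomp Require Import all_boot all_order all_algebra.
From mathcomp Require Import all_classical all_reals.
From mathcomp Require Import topology normedtype derive realfun.
From mathcomp Require Import ring lra.

Set Implicit Arguments.
Unset Strict Implicit.
Unset Printing Implicit Defensive.

Import Order.TTheory GRing.Theory Num.Theory.
Import numFieldNormedType.Exports.
Local Open Scope ring_scope.

Definition bilin (R : realType) (n : nat) (A : 'M[R]_n) (u v : 'cV[R]_n) : R :=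
  (u^T *m A *m v) 0 0.

(** Polarised form of [cubic] and [tensor_uvv], which are convertible to its values on repeated
    arguments and are treated below by folding. *)
Definition trilin (R : realType) (n : nat) (T : tensor3 R n)
    (u v w : 'cV[R]_n) : R :=
  \sum_i \sum_j \sum_k T i j k * u i 0 * v j 0 * w k 0.

(** * Algebra of bilinear and quadratic forms *)

Section BilinearForms.
Context {R : realType} {n : nat}.
Implicit Types (A B : 'M[R]_n) (u v w : 'cV[R]_n) (a : R).

Lemma bilinE A u v : bilin A u v = \sum_i \sum_j u i 0 * A i j * v j 0.
Proof.
rewrite /bilin !mxE exchange_big; apply: eq_bigr => j _ /=.
by rewrite !mxE mulr_suml; apply: eq_bigr => i _; rewrite !mxE.
Qed.

Lemma bilinDl A u v w : bilin A (u + v) w = bilin A u w + bilin A v w.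
Proof. by rewrite /bilin linearD /= !mulmxDl mxE. Qed.

Lemma bilinDr A u v w : bilin A u (v + w) = bilin A u v + bilin A u w.
Proof. by rewrite /bilin mulmxDr mxE. Qed.

Lemma bilinZl A a u v : bilin A (a *: u) v = a * bilin A u v.
Proof. by rewrite /bilin linearZ /= -!scalemxAl mxE. Qed.

Lemma bilinZr A a u v : bilin A u (a *: v) = a * bilin A u v.
Proof. by rewrite /bilin -!scalemxAr mxE. Qed.

Lemma bilinDm A B u v : bilin (A + B) u v = bilin A u v + bilin B u v.
Proof. by rewrite /bilin mulmxDr mulmxDl mxE. Qed.

Lemma bilinZm a A u v : bilin (a *: A) u v = a * bilin A u v.
Proof. by rewrite /bilin -scalemxAr -scalemxAl mxE. Qed.

Lemma bilinNm A u v : bilin (- A) u v = - bilin A u v.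
Proof. by rewrite /bilin mulmxN mulNmx mxE. Qed.

Lemma bilin_sym A u v : symmetric_mx A -> bilin A u v = bilin A v u.
Proof.
move=> A_sym; rewrite !bilinE exchange_big; apply: eq_bigr => i _.
apply: eq_bigr => j _ /=; rewrite -[in LHS]A_sym mxE; ring.
Qed.

Lemma quadDm A B v : quad (A + B) v = quad A v + quad B v.
Proof. exact: bilinDm. Qed.

Lemma quadNm A v : quad (- A) v = - quad A v.
Proof. exact: bilinNm. Qed.

Lemma quadZm a A v : quad (a *: A) v = a * quad A v.
Proof. exact: bilinZm. Qed.

Lemma quadZ A a v : quad A (a *: v) = a ^+ 2 * quad A v.
Proof. by rewrite /quad -!/(bilin _ _ _) bilinZl bilinZr; ring. Qed.

Lemma quadD A u v : symmetric_mx A ->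
  quad A (u + v) = quad A u + 2 * bilin A u v + quad A v.
Proof.
move=> A_sym; rewrite /quad -!/(bilin _ _ _) !(bilinDl, bilinDr).
rewrite (bilin_sym v u A_sym); ring.
Qed.

End BilinearForms.

(** * Algebra of the trilinear form of a tensor *)

Section TrilinearForms.
Context {R : realType} {n : nat}.
Implicit Types (T : tensor3 R n) (u v w : 'cV[R]_n) (a : R).

Lemma trilinD1 T u u' v w : trilin T (u + u') v w = trilin T u v w + trilin T u' v w.
Proof.
rewrite /trilin -big_split; apply: eq_bigr => i _ /=.
rewrite -big_split; apply: eq_bigr => j _ /=.
by rewrite -big_split; apply: eq_bigr => k _ /=; rewrite mxE; ring.
Qed.

Lemma trilinZ1 T a u v w : trilin T (a *: u) v w = a * trilin T u v w.
Proof.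
rewrite /trilin mulr_sumr; apply: eq_bigr => i _ /=.
rewrite mulr_sumr; apply: eq_bigr => j _ /=.
by rewrite mulr_sumr; apply: eq_bigr => k _ /=; rewrite mxE; ring.
Qed.

Lemma trilinZ2 T a u v w : trilin T u (a *: v) w = a * trilin T u v w.
Proof.
rewrite /trilin mulr_sumr; apply: eq_bigr => i _ /=.
rewrite mulr_sumr; apply: eq_bigr => j _ /=.
by rewrite mulr_sumr; apply: eq_bigr => k _ /=; rewrite mxE; ring.
Qed.

Lemma trilinZ3 T a u v w : trilin T u v (a *: w) = a * trilin T u v w.
Proof.
rewrite /trilin mulr_sumr; apply: eq_bigr => i _ /=.
rewrite mulr_sumr; apply: eq_bigr => j _ /=.
by rewrite mulr_sumr; apply: eq_bigr => k _ /=; rewrite mxE; ring.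
Qed.

(** With [trilin_swap23] this generates all permutations of the arguments, so additivity in the
    first one carries over to the others. *)
Lemma trilin_swap12 T u v w : symmetric_tensor T -> trilin T u v w = trilin T v u w.
Proof.
move=> T_sym; rewrite /trilin exchange_big; apply: eq_bigr => i _ /=.
apply: eq_bigr => j _; apply: eq_bigr => k _.
by have [_ -> _ _ _] := T_sym i j k; ring.
Qed.

Lemma trilin_swap23 T u v w : symmetric_tensor T -> trilin T u v w = trilin T u w v.
Proof.
move=> T_sym; rewrite /trilin; apply: eq_bigr => i _ /=.
rewrite exchange_big; apply: eq_bigr => j _; apply: eq_bigr => k _ /=.
by have [-> _ _ _ _] := T_sym i j k; ring.
Qed.

Lemma trilinD2 T u v v' w : symmetric_tensor T ->
  trilin T u (v + v') w = trilin T u v w + trilin T u v' w.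
Proof. by move=> T_sym; rewrite !(trilin_swap12 u _ _ T_sym) trilinD1. Qed.

Lemma trilinD3 T u v w w' : symmetric_tensor T ->
  trilin T u v (w + w') = trilin T u v w + trilin T u v w'.
Proof. by move=> T_sym; rewrite !(trilin_swap23 u v _ T_sym) trilinD2. Qed.

Lemma bilin_tensor_mx T u v w : bilin (tensor_mx T w) u v = trilin T u v w.
Proof.
rewrite bilinE; apply: eq_bigr => i _; apply: eq_bigr => j _.
by rewrite mxE mulr_sumr mulr_suml; apply: eq_bigr => k _; ring.
Qed.

Lemma cubicD T u v : symmetric_tensor T ->
  cubic T (u + v)
    = cubic T u + 3 * trilin T v u u + 3 * trilin T u v v + cubic T v.
Proof.
move=> T_sym; rewrite /cubic -!/(trilin _ _ _ _) trilinD1 !trilinD2 // !trilinD3 //.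
rewrite (trilin_swap23 u u v T_sym) (trilin_swap12 u v u T_sym).
by rewrite (trilin_swap23 v v u T_sym) (trilin_swap12 v u v T_sym); ring.
Qed.

End TrilinearForms.

(** * Cauchy-Schwarz and triangle inequalities for the W-norm *)

Section WeightedNorm.
Context {R : realType} {n : nat}.
Variable W : 'M[R]_n.
Hypothesis W_posdef : posdef W.
Implicit Types (u v : 'cV[R]_n) (a : R).

Lemma quad_ge0 v : 0 <= quad W v.
Proof.
have [->|v0] := eqVneq v 0; last by case: W_posdef => _ /(_ v v0) /ltW.
by rewrite /quad mulmx0 mxE.
Qed.

Lemma wnorm_sqr v : wnorm W v ^+ 2 = quad W v.
Proof. by rewrite sqr_sqrtr// quad_ge0. Qed.

Lemma wnorm_gt0 v : v != 0 -> 0 < wnorm W v.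
Proof. by move=> v0; rewrite sqrtr_gt0; case: W_posdef => _; exact. Qed.

Lemma wnormZ a v : wnorm W (a *: v) = `|a| * wnorm W v.
Proof. by rewrite /wnorm quadZ sqrtrM ?sqr_ge0// sqrtr_sqr. Qed.

Lemma wnorm_CauchySchwarz u v : - (wnorm W u * wnorm W v) <= bilin W u v.
Proof.
have [->|u0] := eqVneq u 0.
  by rewrite /bilin trmx0 !mul0mx mxE oppr_le0 mulr_ge0 ?sqrtr_ge0.
have [->|v0] := eqVneq v 0.
  by rewrite /bilin mulmx0 mxE oppr_le0 mulr_ge0 ?sqrtr_ge0.
(* This quadratic form equals [2 |u| |v| (|u| |v| + u^T W v)]; dividing by [|u| |v| > 0] gives the
   bound. *)
have := quad_ge0 (wnorm W v *: u + wnorm W u *: v).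
rewrite (quadD _ _ (proj1 W_posdef)) !quadZ bilinZl bilinZr -!wnorm_sqr => h.
have p0 : 0 < wnorm W u * wnorm W v by rewrite mulr_gt0// wnorm_gt0.
rewrite -subr_ge0 opprK -(pmulr_rge0 _ p0); nra.
Qed.

Lemma wnorm_sub_le u v : quad W (u - v) <= (wnorm W u + wnorm W v) ^+ 2.
Proof.
rewrite (quadD _ _ (proj1 W_posdef)) -scaleN1r quadZ bilinZr -!wnorm_sqr.
have := wnorm_CauchySchwarz u v; have := wnorm_CauchySchwarz v u; nra.
Qed.

End WeightedNorm.

(** * Attainment of the maximum defining [Lambda] *)

Section TensorNorm.
Context {R : realType} {n : nat}.
Variables (T : tensor3 R n) (W : 'M[R]_n).
Hypothesis W_posdef : posdef W.
Local Open Scope classical_set_scope.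
Implicit Types u v : 'cV[R]_n.

Definition tensor_ratio u v : R :=
  `|tensor_uvv T u v| / (wnorm W u * wnorm W v ^+ 2).

(** Numerator and denominator both scale by [|a| |b|^2]. *)
Lemma tensor_ratioZ (a b : R) u v : a != 0 -> b != 0 ->
  tensor_ratio (a *: u) (b *: v) = tensor_ratio u v.
Proof.
move=> a0 b0; rewrite /tensor_ratio /tensor_uvv -!/(trilin _ _ _ _).
rewrite trilinZ1 trilinZ2 trilinZ3 !wnormZ !normrM.
have -> : `|a| * wnorm W u * (`|b| * wnorm W v) ^+ 2
          = `|a| * `|b| ^+ 2 * (wnorm W u * wnorm W v ^+ 2) by ring.
rewrite [X in X / _](_ : _ = `|a| * `|b| ^+ 2 * `|trilin T u v v|); last by ring.
rewrite -mulf_div divff ?mul1r//.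
by rewrite mulf_neq0 ?expf_neq0 ?normr_eq0.
Qed.

(** Compactness is obtained below for sets of row vectors, so continuity is proved for functions of
    rows transposed to columns. *)
Lemma continuous_tr_coord (V : topologicalType) (f : V -> 'rV[R]_n) i :
  continuous f -> continuous (fun x => (f x)^T i 0).
Proof.
move=> f_cont; have -> : (fun x => (f x)^T i 0) = (fun M : 'rV[R]_n => M 0 i) \o f.
  by apply/funext => x; rewrite mxE.
by move=> x; apply: continuous_comp; [exact: f_cont|exact: coord_continuous].
Qed.

Lemma continuous_quad_tr (V : topologicalType) (f : V -> 'rV[R]_n) :
  continuous f -> continuous (fun x => quad W (f x)^T).
Proof.
move=> f_cont.
under eq_fun do rewrite /quad -/(bilin _ _ _) bilinE.
have c i : continuous (fun x => (f x)^T i 0) by exact: continuous_tr_coord.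
apply: continuous_big => [|i _]; first exact: add_continuous.
apply: continuous_big => [|j _]; first exact: add_continuous.
by move=> x; apply: cvgM; [apply: cvgM; [exact: c|exact: cvg_cst]|exact: c].
Qed.

Lemma continuous_tensor_uvv_tr :
  continuous (fun x : 'rV[R]_n * 'rV[R]_n => tensor_uvv T x.1^T x.2^T).
Proof.
have c1 i : continuous (fun x : 'rV[R]_n * 'rV[R]_n => x.1^T i 0).
  by apply: continuous_tr_coord => x; exact: cvg_fst.
have c2 i : continuous (fun x : 'rV[R]_n * 'rV[R]_n => x.2^T i 0).
  by apply: continuous_tr_coord => x; exact: cvg_snd.
apply: continuous_big => [|i _]; first exact: add_continuous.
apply: continuous_big => [|j _]; first exact: add_continuous.
apply: continuous_big => [|k _]; first exact: add_continuous.
move=> x; apply: cvgM; last exact: c2.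
by apply: cvgM; [apply: cvgM; [exact: cvg_cst|exact: c1]|exact: c2].
Qed.

Lemma continuous_tensor_ratio_tr (x : 'rV[R]_n * 'rV[R]_n) :
  x.1 != 0 -> x.2 != 0 ->
  {for x, continuous (fun x : 'rV[R]_n * 'rV[R]_n => tensor_ratio x.1^T x.2^T)}.
Proof.
move=> x10 x20.
have N (f : 'rV[R]_n * 'rV[R]_n -> 'rV[R]_n) : continuous f ->
    {for x, continuous (fun x => wnorm W (f x)^T)}.
  move=> f_cont; apply: (@continuous_comp _ _ _ (fun x => quad W (f x)^T)).
    exact: continuous_quad_tr.
  exact: sqrt_continuous.
have tr0 (u : 'rV[R]_n) : u != 0 -> wnorm W u^T != 0.
  by move=> u0; rewrite gt_eqF// wnorm_gt0// trmx_eq0.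
apply: cvgM.
  by apply: cvg_norm; exact: continuous_tensor_uvv_tr.
apply: cvgV; first by rewrite mulf_neq0// ?expf_neq0 ?tr0.
apply: cvgM; first by apply: N => y; exact: cvg_fst.
by under eq_fun do rewrite expr2; apply: cvgM; apply: N => y; exact: cvg_snd.
Qed.

(** The norm here is the sup norm, not the W-norm; the sphere is bounded, and closed as the preimage
    of a point. *)
Lemma compact_unit_sphere : compact [set u : 'rV[R]_n | `|u| = 1].
Proof.
apply: bounded_closed_compact.
  by exists 1; split => // M M1 u /= ->; exact: ltW.
have -> : [set u : 'rV[R]_n | `|u| = 1] = Num.norm @^-1` [set 1] by [].
by apply: closed_comp => [u _|]; [exact: norm_continuous|exact: closed_eq].
Qed.

(* By homogeneity the quotient may be maximised over the compact product of two
   unit spheres of the sup norm, where it is continuous. *)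
Lemma tensor_ratio_max u v : u != 0 -> v != 0 ->
  exists u0 v0 : 'cV[R]_n, [/\ u0 != 0, v0 != 0
    & forall u' v', u' != 0 -> v' != 0 -> tensor_ratio u' v' <= tensor_ratio u0 v0].
Proof.
move=> u_neq0 v_neq0; pose S := [set u : 'rV[R]_n | `|u| = 1].
pose unit (w : 'cV[R]_n) : 'rV[R]_n := `|w^T|^-1 *: w^T.
have norm_neq0 (w : 'cV[R]_n) : w != 0 -> `|w^T|^-1 != 0.
  by move=> w0; rewrite invr_eq0 normr_eq0 trmx_eq0.
have unitS w : w != 0 -> S (unit w).
  by move=> w0; rewrite /S /unit /= normrZ normfV normr_id mulVf// normr_eq0 trmx_eq0.
have S_neq0 w : S w -> w != 0.
  by rewrite /S /= => w1; rewrite -normr_eq0 w1 oner_eq0.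
have [||x|[x1 x2]] := @compact_EVT_max _ _
    (fun x : 'rV[R]_n * 'rV[R]_n => tensor_ratio x.1^T x.2^T) (S `*` S).
(* The given nonzero vectors make the domain nonempty. *)
- by exists (unit u, unit v); split; exact: unitS.
- by apply: compact_setX; exact: compact_unit_sphere.
- move: x; apply: continuous_in_subspaceT => x /set_mem[x1S x2S].
  by apply: continuous_tensor_ratio_tr; exact: S_neq0.
move=> /set_mem[/= x1S x2S] x_max; exists x1^T, x2^T.
split; [by rewrite trmx_eq0 S_neq0|by rewrite trmx_eq0 S_neq0|].
move=> u' v' u'0 v'0.
have /x_max /= : (unit u', unit v') \in S `*` S.
  by apply/mem_set; split; exact: unitS.
by rewrite /unit !linearZ /= !trmxK tensor_ratioZ ?norm_neq0.
Qed.

(** If [u] or [v] is zero, both sides vanish. Otherwise the maximum is attained and [Lambda] bounds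
    every quotient. *)
Lemma tensor_uvv_le u v :
  `|tensor_uvv T u v| <= Lambda W T * wnorm W u * wnorm W v ^+ 2.
Proof.
have [->|u0] := eqVneq u 0.
  rewrite -(scale0r 0) wnormZ /tensor_uvv -/(trilin _ _ _ _) trilinZ1.
  by rewrite mul0r !normr0 mul0r mulr0 mul0r.
have [->|v0] := eqVneq v 0.
  rewrite -(scale0r 0) wnormZ /tensor_uvv -/(trilin _ _ _ _) trilinZ2.
  by rewrite mul0r !normr0 mul0r expr0n mulr0.
rewrite -mulrA -ler_pdivrMr; last first.
  by rewrite mulr_gt0 ?exprn_gt0 ?wnorm_gt0.
have [u1 [v1 [u10 v10 uv_max]]] := tensor_ratio_max u0 v0.
rewrite /Lambda /set_max; set A := [set r | _].
(* An explicit greatest element excludes the default value of [xget]. *)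
have A_max : (A `&` ubound A) (tensor_ratio u1 v1).
  split; first by exists u1, v1.
  by move=> r [u' [v' [u'0 v'0 ->]]]; exact: uv_max.
have [_] := xgetI 0 A_max.
by apply; exists u, v.
Qed.

End TensorNorm.

(** Stationarity cancels the terms of the expansion that are linear in [v]. For the quartic term,
    with [P = |s + v|_W^2] and [Q = |s|_W^2], one has [P^2 - Q^2 = (P - Q)^2 + 2 Q (P - Q)], where
    [P - Q = 2 s^T W v + |v|_W^2]. *)
Lemma m3D (R : realType) (n : nat) (f0 : R) (g : 'cV[R]_n) (H : 'M[R]_n)
    (T : tensor3 R n) (sigma : R) (W : 'M[R]_n) (s v : 'cV[R]_n) :
  symmetric_mx H -> symmetric_tensor T -> posdef W ->
  (H + (1 / 2) *: tensor_mx T s + (sigma * wnorm W s ^+ 2) *: W) *m s = - g ->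
  m3 f0 g H T sigma W (s + v) - m3 f0 g H T sigma W s
    = 1 / 2 * (quad H v + trilin T s v v + sigma * wnorm W s ^+ 2 * quad W v)
      + 1 / 6 * cubic T v
      + sigma / 4 * (wnorm W (s + v) ^+ 2 - wnorm W s ^+ 2) ^+ 2.
Proof.
move=> H_sym T_sym W_posdef stat.
have W_sym := proj1 W_posdef.
(* The first-order condition paired with [v]. *)
have gE : (g^T *m v) 0 0 = - (bilin H s v + 1 / 2 * trilin T v s s
    + sigma * wnorm W s ^+ 2 * bilin W s v).
  have -> : (g^T *m v) 0 0 = (v^T *m g) 0 0.
    by rewrite !mxE; apply: eq_bigr => i _; rewrite !mxE mulrC.
  rewrite -[g]opprK -stat mulmxN mxE mulmxA -/(bilin _ _ _).
  by rewrite !bilinDm !bilinZm bilin_tensor_mx !(bilin_sym v s).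
rewrite /m3 mulmxDr [in X in X - _]mxE gE cubicD// quadD//.
by rewrite !(exprM _ 2 2) !(wnorm_sqr W_posdef) quadD//; field.
Qed.

Theorem theorem2p2 (R : realType) (n : nat) (f0 : R) (g : 'cV[R]_n)
    (H : 'M[R]_n) (T : tensor3 R n) (sigma : R) (W : 'M[R]_n)
    (sstar : 'cV[R]_n)
    (H_sym : symmetric_mx H)
    (T_sym : symmetric_tensor T)
    (sigma_gt0 : 0 < sigma)
    (W_posdef : posdef W)
    (first_order :
      (H + (1 / 2) *: tensor_mx T sstar
         + (sigma * wnorm W sstar ^+ 2) *: W) *m sstar = - g)
    (second_order :
      psd (H + (2 / 3) *: tensor_mx T sstar
             + (sigma * wnorm W sstar ^+ 2) *: W
             - (Lambda W T / 3 * wnorm W sstar) *: W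
             - (Lambda W T ^+ 2 / (18 * sigma)) *: W)) :
  global_minimum (m3 f0 g H T sigma W) sstar.
Proof.
move=> y; pose v := y - sstar.
have yE : y = sstar + v by rewrite /v addrC subrK.
rewrite -subr_ge0 yE m3D// -yE.
have [_ /(_ v)] := second_order.
rewrite !(quadDm, quadNm, quadZm).
have -> : quad (tensor_mx T sstar) v = trilin T sstar v v.
  by rewrite /quad -/(bilin _ _ _) bilin_tensor_mx (trilin_swap23 v v) // trilin_swap12.
have : - (Lambda W T * wnorm W y * quad W v) <= trilin T y v v.
  have := tensor_uvv_le T W_posdef y v.
  by rewrite (wnorm_sqr W_posdef) ler_norml => /andP[].
rewrite {2}yE trilinD1 -[trilin T v v v]/(cubic T v).
have := wnorm_sub_le W_posdef y sstar; rewrite -/v.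
have := quad_ge0 W_posdef v.
(* What remains is an inequality between real numbers, with [d = |v|_W^2], [p = |y|_W] and
   [q = |sstar|_W]. *)
move: (quad W v) (quad H v) (trilin T sstar v v) (cubic T v) (Lambda W T).
move: (wnorm W y) (wnorm W sstar) => p q d h t c L d_ge0 d_le tL so.
(* The perfect square of the final bound, with [1 / sigma] factored out. *)
have sq : 0 <= d / sigma * (sigma / 2 * (p - q) - L / 6) ^+ 2.
  by rewrite mulr_ge0 ?sqr_ge0// divr_ge0// ltW.
have sqE : d / sigma * (sigma / 2 * (p - q) - L / 6) ^+ 2
    = sigma / 4 * ((p - q) ^+ 2 * d) - L / 6 * (p - q) * d
      + L ^+ 2 / (18 * sigma) * d / 2.
  by field; rewrite gt_eqF.
(* Factor [(p^2 - q^2)^2 = (p - q)^2 (p + q)^2] and use [d <= (p + q)^2]. *)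
have : sigma / 4 * ((p - q) ^+ 2 * d) <= sigma / 4 * (p ^+ 2 - q ^+ 2) ^+ 2.
  rewrite subr_sqr exprMn ler_wpM2l ?ler_wpM2l ?sqr_ge0//.
  by rewrite divr_ge0// ltW.
(* With the quotient abstracted as [M], the goal is linear in its monomials: it is the sum of half
   of [so], a sixth of [tL], [sq] and [quart]. *)
rewrite sqE in sq; move: (L ^+ 2 / _) sq so => M sq so quart.
lra.
Qed.
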